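(* Let the dihedral group $D$ of order $20$ generated by the permutations $(1,2,\dots,10)$ and $(2,10)(3,9)(4,8)(5,7)$, i.e. the automorphism group of the cycle graph on $1,2,\dots,10$, act on the vertices of $J(10,3)$. The orbits of this action are exactly the eight sets $A,B,C,D',E,F,G,H$, where a $3$-subset belongs to a given set when the multiset of its three pairwise cycle distances is, respectively, $$A:\{1,1,2\},\quad B:\{1,2,3\},\quad C:\{1,3,4\},\quad D':\{1,4,5\},\quad E:\{2,2,4\},\quad F:\{2,3,5\},\quad G:\{2,4,4\},\quad H:\{3,3,4\}.$$ In this order they form a perfect $8$-coloring of $J(10,3)$ with quotient matrix $$\begin{bmatrix} 2&6&4&4&2&2&1&0\\ 3&3&4&2&2&4&1&2\\ 2&4&3&4&1&2&2&3\\ 2&2&4&5&1&4&2&1\\ 2&4&2&2&2&4&4&1\\ 1&4&2&4&2&5&1&2\\ 1&2&4&4&4&2&2&2\\ 0&4&6&2&1&4&2&2 \end{bmatrix}.$$ Moreover, with $P_1=A\cup B\cup C\cup H$, $P_2=D'\cup E\cup F\cup G$, $P_1'=C\cup D'\cup G\cup H$, $P_2'=A\cup B\cup E\cup F$, both $\{P_1,P_2\}$ and $\{P_1',P_2'\}$ are perfect $2$-colorings of $J(10,3)$ with quotient matrix $\begin{bmatrix} 12 & 9\\ 9 & 12\end{bmatrix}$, and these two perfect $2$-colorings are not isomorphic.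
   Context: The Johnson graph $J(10,3)$ has as vertices the $3$-subsets of $[10]=\{1,\dots,10\}$; two vertices $x,y$ are adjacent when $|x\cap y|=2$. A perfect $m$-coloring of $J(10,3)$ with quotient matrix $[p_{i,j}]_{1\le i,j\le m}$ is a partition of the vertex set into parts $P_1,\dots,P_m$ such that for all $i,j$ every vertex in $P_i$ has exactly $p_{i,j}$ neighbors in $P_j$. The cycle distance between $a,b\in[10]$ is $\min(|a-b|,10-|a-b|)$, the graph distance in the cycle graph on $1,2,\dots,10$ (with $i$ adjacent to $i+1$ and $10$ adjacent to $1$). Two perfect $2$-colorings (regarded as unordered partitions) are isomorphic if some automorphism of $J(10,3)$, equivalently some permutation of $[10]$ acting on $3$-subsets, maps one partition to the other. *)

(* Defs.v *)
From mathcomp Require Import all_boot all_algebra all_fingroup all_solvable.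

Set Implicit Arguments.
Unset Strict Implicit.
Unset Printing Implicit Defensive.

(* A finite simple graph is given by its vertex set V, inside an ambient
   finType T, and an adjacency relation e that only matters on V. *)

(* The permutations of V, seen as permutations of T fixing T outside V. *)
Definition graph_aut (T : finType) (V : {set T}) (e : rel T) :
    {set {perm T}} :=
  [set s | perm_on V s &
     [forall x in V, forall y in V, e (s x) (s y) == e x y]].

(* mathcomp's [partition] also requires the parts to be nonempty. *)
Definition perfect_coloring (T : finType) (V : {set T}) (e : rel T) (m : nat)
    (P : m.-tuple {set T}) (M : 'M[nat]_m) : Prop :=
  [/\ uniq P, partition [set:: P] V &
      forall (i j : 'I_m) (x : T), x \in tnth P i ->
        #|[set y in tnth P j | e x y]| = M i j].

(* Colorings are compared as unordered partitions. *)
Definition isomorphic_partitions (T : finType) (V : {set T}) (e : rel T)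
    (Q Q' : {set {set T}}) : Prop :=
  exists2 s : {perm T}, s \in graph_aut V e & [set s @: X | X : {set T} in Q] = Q'.

Definition mx_of_rows (m : nat) (rows : seq (seq nat)) : 'M[nat]_m :=
  (\matrix_(i < m, j < m) nth 0%N (nth [::] rows i) j)%R.

(* The set [10] = {1, ..., 10} is 'I_10; the element k of [10], for
   1 <= k <= 10, is the ordinal of value k - 1. *)
Definition pt (k : nat) : 'I_10 := inord k.-1.

Definition johnson_vertices : {set {set 'I_10}} := [set x : {set 'I_10} | #|x| == 3].

Definition johnson_adj : rel {set 'I_10} := fun x y => #|x :&: y| == 2.

(* [ordS] is the cyclic successor. *)
Definition cycle_adj : rel 'I_10 := fun a b => (b == ordS a) || (a == ordS b).

Definition cycle_dist (a b : 'I_10) : nat :=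
  let d := absz (a%:Z - b%:Z)%R in minn d (10 - d).

(* (1,2,...,10) *)
Definition rot10 : {perm 'I_10} := perm (@ordS_inj 10).

Definition refl10 : {perm 'I_10} :=
  (tperm (pt 2) (pt 10) * tperm (pt 3) (pt 9) *
   tperm (pt 4) (pt 8) * tperm (pt 5) (pt 7))%g.

Definition dihedral10 : {group {perm 'I_10}} := <<[set rot10; refl10]>>%G.

(* The pairs a < b enumerate each unordered pair once; multisets are
   sequences up to [perm_eq]. *)
Definition pair_dists (x : {set 'I_10}) : seq nat :=
  [seq cycle_dist p.1 p.2 | p : 'I_10 * 'I_10 <- enum (setX x x) & p.1 < p.2].

Definition dist_class (d : seq nat) : {set {set 'I_10}} :=
  [set x in johnson_vertices | perm_eq (pair_dists x) d].

Definition classA := dist_class [:: 1; 1; 2].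
Definition classB := dist_class [:: 1; 2; 3].
Definition classC := dist_class [:: 1; 3; 4].
Definition classD := dist_class [:: 1; 4; 5].
Definition classE := dist_class [:: 2; 2; 4].
Definition classF := dist_class [:: 2; 3; 5].
Definition classG := dist_class [:: 2; 4; 4].
Definition classH := dist_class [:: 3; 3; 4].

Definition part1 := classA :|: classB :|: classC :|: classH.
Definition part2 := classD :|: classE :|: classF :|: classG.
Definition part1' := classC :|: classD :|: classG :|: classH.
Definition part2' := classA :|: classB :|: classE :|: classF.

Definition quotient8 : 'M[nat]_8 := mx_of_rows 8
  [:: [:: 2; 6; 4; 4; 2; 2; 1; 0];
      [:: 3; 3; 4; 2; 2; 4; 1; 2];
      [:: 2; 4; 3; 4; 1; 2; 2; 3];
      [:: 2; 2; 4; 5; 1; 4; 2; 1];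
      [:: 2; 4; 2; 2; 2; 4; 4; 1];
      [:: 1; 4; 2; 4; 2; 5; 1; 2];
      [:: 1; 2; 4; 4; 4; 2; 2; 2];
      [:: 0; 4; 6; 2; 1; 4; 2; 2]].

Definition quotient2 : 'M[nat]_2 := mx_of_rows 2 [:: [:: 12; 9]; [:: 9; 12]].

(* Main.v *)
(* A set of points is represented by the increasing list of its values, so that
   every count over the 120 vertices becomes a computation on lists of naturals.
   The elements of the dihedral group are the refl10^b * rot10^i, because an
   automorphism of a cycle is determined by the images of two adjacent vertices.
   The 2-colorings are told apart by the number of common neighbours that two
   adjacent vertices of a part have inside that part. *)

Require Import Defs.
From mathcomp Require Import all_boot all_algebra all_fingroup all_solvable.

Set Implicit Arguments.
Unset Strict Implicit.
Unset Printing Implicit Defensive.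

(** * Vertices of $J(10,3)$ as increasing lists of naturals *)

Definition trace (x : {set 'I_10}) : seq nat := [seq val i | i <- enum x].

Definition of_trace (s : seq nat) : {set 'I_10} := [set i | val i \in s].

Definition triples : seq (seq nat) :=
  [seq s <- [seq i :: p | i <- iota 0 10,
                          p <- [seq [:: j; k] | j <- iota 0 10, k <- iota 0 10]]
  | sorted ltn s].

Definition trace_adj (s t : seq nat) : bool := count (mem t) s == 2.

Definition trace_dist (a b : nat) : nat :=
  let d := absz (a%:Z - b%:Z)%R in minn d (10 - d).

Definition trace_dists (s : seq nat) : seq nat :=
  [seq trace_dist p.1 p.2
     | p <- [seq q <- [seq (a, b) | a <- s, b <- s] | q.1 < q.2]].

Definition class_dists : seq (seq nat) :=
  [:: [:: 1; 1; 2]; [:: 1; 2; 3]; [:: 1; 3; 4]; [:: 1; 4; 5];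
      [:: 2; 2; 4]; [:: 2; 3; 5]; [:: 2; 4; 4]; [:: 3; 3; 4]].

(** [find] returns 8 when no class matches; [color8_lt] rules this out on vertices. *)
Definition color8 (s : seq nat) : nat := find (perm_eq (trace_dists s)) class_dists.

Lemma mem_trace (x : {set 'I_10}) i : (val i \in trace x) = (i \in x).
Proof. by rewrite mem_map ?mem_enum //; apply: val_inj. Qed.

Lemma traceK : cancel trace of_trace.
Proof. by move=> x; apply/setP=> i; rewrite inE mem_trace. Qed.

(** The round trip on an arbitrary list sorts it and drops repetitions and entries above 9. *)
Lemma of_traceK s : trace (of_trace s) = [seq i <- iota 0 10 | i \in s].
Proof.
rewrite /trace -val_enum_ord filter_map; congr map.
by rewrite {1}/enum_mem -enumT; apply: eq_filter => i; rewrite /= inE.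
Qed.

Lemma trace_subseq x : subseq (trace x) (iota 0 10).
Proof. by rewrite -[x]traceK of_traceK filter_subseq. Qed.

Lemma size_trace x : size (trace x) = #|x|.
Proof. by rewrite size_map cardE. Qed.

Lemma trace_triples x : x \in johnson_vertices -> trace x \in triples.
Proof.
rewrite inE -size_trace => /eqP sz3; rewrite mem_filter.
have ->: sorted ltn (trace x).
  exact: subseq_sorted ltn_trans _ _ (trace_subseq x) (iota_ltn_sorted 0 10).
move: (mem_subseq (trace_subseq x)) sz3.
case: (trace x) => [|i [|j [|k []]]] // sub _; rewrite andTb.
apply: (allpairs_f cons); first by rewrite sub // !inE eqxx.
by apply: (allpairs_f (fun j k => [:: j; k])); rewrite sub // !inE eqxx ?orbT.
Qed.

Lemma triples_trace s :
  s \in triples -> trace (of_trace s) = s /\ of_trace s \in johnson_vertices.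
Proof.
have /allP triplesP : all (fun s => ([seq i <- iota 0 10 | i \in s] == s)
                                    && (size s == 3)) triples by vm_compute.
move=> /triplesP /andP[/eqP sK sz3]; rewrite inE -size_trace of_traceK sK.
by split.
Qed.

(** [trace] is injective and [triples] lists its values on the vertices without repetition, so
    counting vertices becomes counting lists, which [vm_compute] can do. *)
Lemma card_traces (q : pred (seq nat)) :
  #|[set x in johnson_vertices | q (trace x)]| = count q triples.
Proof.
have : uniq triples by vm_compute.
(* [triples] is made abstract, known only by its properties, so that nothing below unfolds it. *)
move: triples trace_triples triples_trace => T traceT T_trace uniqT.
rewrite cardE -(size_map trace) -size_filter.
apply/perm_size/uniq_perm; rewrite ?filter_uniq //.
  by rewrite map_inj_uniq ?enum_uniq //; apply: can_inj traceK.
move=> s; rewrite mem_filter; apply/mapP/andP=> [[x]|[qs /T_trace[sK Vs]]].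
  by rewrite mem_enum inE => /andP[/traceT ? ?] ->.
by exists (of_trace s); rewrite ?sK // mem_enum inE Vs sK.
Qed.

Lemma johnson_adj_trace x y : johnson_adj x y = trace_adj (trace x) (trace y).
Proof.
rewrite /trace_adj -size_filter filter_map size_map /johnson_adj cardE.
rewrite [enum x]/enum_mem [enum (x :&: y)]/enum_mem -filter_predI.
congr (size _ == 2).
by apply: eq_filter => i; rewrite /= mem_trace andbC inE.
Qed.

Lemma pair_dists_trace x : perm_eq (pair_dists x) (trace_dists (trace x)).
Proof.
have dists_val : trace_dists (trace x) = [seq cycle_dist p.1 p.2
    | p : 'I_10 * 'I_10 <-
        [seq q : 'I_10 * 'I_10 <- [seq (a, b) | a <- enum x, b <- enum x]
        | q.1 < q.2]].
  rewrite /trace_dists /trace allpairs_mapl allpairs_mapr.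
  rewrite -(map_allpairs (fun p : 'I_10 * 'I_10 => (val p.1, val p.2)) pair).
  by rewrite filter_map -map_comp.
rewrite dists_val; apply/perm_map/uniq_perm.
- exact/filter_uniq/enum_uniq.
- by rewrite filter_uniq // allpairs_uniq ?enum_uniq // => [[? ?] [? ?]].
move=> [a b]; rewrite [LHS]mem_filter [RHS]mem_filter; congr (_ && _).
transitivity ((a, b) \in setX x x); first exact: mem_enum.
rewrite in_setX; apply/andP/allpairsP => [[xa xb]|[[c d] /= [xc xd [-> ->]]]].
  by exists (a, b); rewrite !mem_enum.
by move: xc xd; rewrite !mem_enum => -> ->.
Qed.

(** * Perfect colorings verified by computation *)

(** Colors below [m] make the parts cover the vertices; every color occurring makes them nonempty; a
    vertex has a single color, so they are disjoint, and being inhabited they are distinct. The last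
    check compares neighbour counts with the rows. *)
Lemma coloring_by_trace m (P : m.-tuple {set {set 'I_10}}) rows
    (c : seq nat -> nat) :
    (forall i x,
      (x \in tnth P i) = (x \in johnson_vertices) && (c (trace x) == i)) ->
    all (fun s => c s < m) triples ->
    all (fun i => has (fun s => c s == i) triples) (iota 0 m) ->
    all (fun s =>
      let nbr_colors := [seq c t | t <- triples & trace_adj s t] in
      all (fun j => count_mem j nbr_colors == nth 0 (nth [::] rows (c s)) j)
          (iota 0 m)) triples ->
  perfect_coloring johnson_vertices johnson_adj P (mx_of_rows m rows).
Proof.
move=> memP c_lt c_onto c_count.
have P_inh i : exists x, x \in tnth P i.
  have /(allP c_onto)/hasP[s Ts cs] : val i \in iota 0 m by rewrite mem_iota ltn_ord.
  have [sK Vs] := triples_trace Ts.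
  by exists (of_trace s); rewrite memP Vs sK.
have P_disj i j x : x \in tnth P i -> x \in tnth P j -> i = j.
  rewrite !memP => /andP[_ /eqP ci] /andP[_ /eqP cj].
  by apply: ord_inj; rewrite -ci -cj.
have P_inj : injective (tnth P).
  by move=> i j eqP; have [x Pix] := P_inh i; apply: (P_disj _ _ x); rewrite -?eqP.
split.
- exact/tuple_uniqP.
- apply/and3P; split.
  + rewrite /cover; apply/eqP/setP=> x; apply/bigcupP/idP => [[B]|Vx].
      by rewrite inE => /tnthP[i ->]; rewrite memP => /andP[].
    have lt_cx := allP c_lt _ (trace_triples Vx).
    exists (tnth P (Ordinal lt_cx)); first by rewrite inE mem_tnth.
    by rewrite memP Vx; apply: eqxx.
  + apply/trivIsetP=> B C; rewrite !inE => /tnthP[i ->] /tnthP[j ->] neq_ij.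
    rewrite -setI_eq0; apply: contraNT neq_ij => /set0Pn[x /setIP[Pi Pj]].
    by rewrite (P_disj _ _ _ Pi Pj).
  + rewrite inE; apply/negP=> /tnthP[i P0]; have [x] := P_inh i.
    by rewrite -P0 inE.
move=> i j x; rewrite memP => /andP[/trace_triples Tx /eqP cx].
have /allP/(_ (val j)) := allP c_count _ Tx.
rewrite mem_iota ltn_ord cx mxE => /(_ isT)/eqP <-.
rewrite count_map count_filter -card_traces.
by apply: eq_card => y; rewrite !inE memP johnson_adj_trace inE -andbA.
Qed.

(** A finite check on the 120 lists: the eight multisets exclude one another, so the first match
    found by [color8] is the only one. *)
Lemma mem_dist_class i x : i < 8 ->
  (x \in dist_class (nth [::] class_dists i)) =
  (x \in johnson_vertices) && (color8 (trace x) == i).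
Proof.
have /allP colorP : all (fun s => all (fun i =>
    perm_eq (trace_dists s) (nth [::] class_dists i) == (color8 s == i))
      (iota 0 8)) triples by vm_compute.
move=> lt_i8; rewrite inE; case Vx: (x \in johnson_vertices) => //=.
have /allP/(_ i) := colorP _ (trace_triples Vx).
rewrite mem_iota => /(_ lt_i8)/eqP <-.
by have /permPl-> := pair_dists_trace x.
Qed.

Lemma classes_coloring :
  perfect_coloring johnson_vertices johnson_adj
    [tuple classA; classB; classC; classD; classE; classF; classG; classH]
    quotient8.
Proof.
apply: (@coloring_by_trace 8 _ _ color8); [|by vm_compute..].
move=> i x; rewrite -mem_dist_class //; congr (x \in _).
by case: i => [[|[|[|[|[|[|[|[|]]]]]]]]].
Qed.

(** The Boolean is read as a color 0 or 1, and [I] holds the indices of the classes merged into the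
    second part: 3, 4, 5, 6 for [part2] and 0, 1, 4, 5 for [part2']. *)
Definition color2 (I : seq nat) (s : seq nat) : nat := color8 s \in I.

Lemma color8_lt x : x \in johnson_vertices -> color8 (trace x) < 8.
Proof.
have /allP ltP : all (fun s => color8 s < 8) triples by vm_compute.
by move/trace_triples/ltP.
Qed.

Lemma mem_part1 x : (x \in part1) =
  (x \in johnson_vertices) && (color2 [:: 3; 4; 5; 6] (trace x) == 0).
Proof.
rewrite !in_setU (@mem_dist_class 0) ?(@mem_dist_class 1) //.
rewrite (@mem_dist_class 2) ?(@mem_dist_class 7) // /color2 -!andb_orr.
(* Color 0 only says that the index is not listed; the bound 8 leaves exactly the four classes of
   [part1]. *)
case Vx: (x \in _) => //=; move: (color8 _) (color8_lt Vx).
by do 8?[case=> //].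
Qed.

Lemma mem_part2 x : (x \in part2) =
  (x \in johnson_vertices) && (color2 [:: 3; 4; 5; 6] (trace x) == 1).
Proof.
rewrite !in_setU (@mem_dist_class 3) ?(@mem_dist_class 4) //.
rewrite (@mem_dist_class 5) ?(@mem_dist_class 6) // /color2 -!andb_orr.
by rewrite !inE -!orbA eqb1.
Qed.

Lemma mem_part1' x : (x \in part1') =
  (x \in johnson_vertices) && (color2 [:: 0; 1; 4; 5] (trace x) == 0).
Proof.
rewrite !in_setU (@mem_dist_class 2) ?(@mem_dist_class 3) //.
rewrite (@mem_dist_class 6) ?(@mem_dist_class 7) // /color2 -!andb_orr.
case Vx: (x \in _) => //=; move: (color8 _) (color8_lt Vx).
by do 8?[case=> //].
Qed.

Lemma mem_part2' x : (x \in part2') =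
  (x \in johnson_vertices) && (color2 [:: 0; 1; 4; 5] (trace x) == 1).
Proof.
rewrite !in_setU (@mem_dist_class 0) ?(@mem_dist_class 1) //.
rewrite (@mem_dist_class 4) ?(@mem_dist_class 5) // /color2 -!andb_orr.
by rewrite !inE -!orbA eqb1.
Qed.

Lemma parts_coloring :
  perfect_coloring johnson_vertices johnson_adj [tuple part1; part2] quotient2.
Proof.
apply: (@coloring_by_trace 2 _ _ (color2 [:: 3; 4; 5; 6])); [|by vm_compute..].
by case=> [[|[|//]]] i_lt x; rewrite (tnth_nth set0) ?mem_part1 ?mem_part2.
Qed.

Lemma parts'_coloring :
  perfect_coloring johnson_vertices johnson_adj [tuple part1'; part2'] quotient2.
Proof.
apply: (@coloring_by_trace 2 _ _ (color2 [:: 0; 1; 4; 5])); [|by vm_compute..].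
by case=> [[|[|//]]] i_lt x; rewrite (tnth_nth set0) ?mem_part1' ?mem_part2'.
Qed.

(** * Non-isomorphism of the two 2-colorings *)

(** The automorphism [s] maps the common neighbours of [x] and [y] in [P] bijectively onto those of
    their images in [s @: P]. Adjacency is preserved only on [V], whence [P \subset V]. *)
Lemma card_common_aut (T : finType) (V P : {set T}) (e : rel T) (s : {perm T}) x y :
    s \in graph_aut V e -> P \subset V -> x \in P -> y \in P ->
  #|[set z in s @: P | e (s x) z && e (s y) z]| = #|[set z in P | e x z && e y z]|.
Proof.
rewrite inE => /andP[_ aut_s] /subsetP sPV Px Py.
have se a b : a \in P -> b \in P -> e (s a) (s b) = e a b.
  move=> /sPV Va /sPV Vb.
  by have /forall_inP/(_ b Vb)/eqP := forall_inP aut_s a Va.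
rewrite -[RHS](card_imset _ (@perm_inj _ s)); apply: eq_card => z.
rewrite inE; apply/andP/imsetP => [[/imsetP[t Pt ->]]|[t]].
  by rewrite !se // => e_t; exists t; rewrite // inE Pt.
by rewrite inE => /andP[Pt e_t] ->; rewrite imset_f // !se.
Qed.

Definition trace_part (I : seq nat) (k : nat) : seq (seq nat) :=
  [seq s <- triples | color2 I s == k].

Definition trace_common (T : seq (seq nat)) (s t : seq nat) : nat :=
  count (fun u => trace_adj s u && trace_adj t u) T.

(* [T] is a parameter so that call-by-value reduction evaluates it only once. *)
Definition common_neq (T : seq (seq nat)) (n : nat) : bool :=
  all (fun s => all (fun t => trace_common T s t != n)
                    [seq t <- T | trace_adj s t]) T.

Section TracePart.

Variables (P : {set {set 'I_10}}) (I : seq nat) (k : nat).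
Hypothesis memP : forall x,
  (x \in P) = (x \in johnson_vertices) && (color2 I (trace x) == k).

Lemma mem_trace_part x : x \in P -> trace x \in trace_part I k.
Proof. by rewrite memP mem_filter => /andP[/trace_triples-> ->]. Qed.

Lemma trace_part_of_trace s : s \in trace_part I k ->
  trace (of_trace s) = s /\ of_trace s \in P.
Proof.
rewrite mem_filter => /andP[cs /triples_trace[sK Vs]].
by rewrite memP Vs sK.
Qed.

Lemma card_common_trace x y :
  #|[set z in P | johnson_adj x z && johnson_adj y z]|
    = trace_common (trace_part I k) (trace x) (trace y).
Proof.
pose q t := [&& trace_adj (trace x) t, trace_adj (trace y) t & color2 I t == k].
rewrite /trace_common count_filter; transitivity (count q triples).
  rewrite -card_traces; apply: eq_card => z.
  rewrite [LHS]inE [RHS]inE memP !johnson_adj_trace -andbA; congr (_ && _).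
  by rewrite andbC -andbA.
by apply: eq_count => t; rewrite /q /= andbA.
Qed.

Lemma common_neq2 :
    common_neq (trace_part I k) 2 ->
  forall x y, x \in P -> y \in P -> johnson_adj x y ->
    #|[set z in P | johnson_adj x z && johnson_adj y z]| != 2.
Proof.
move=> ne2 x y /mem_trace_part Tx /mem_trace_part Ty e_xy.
rewrite card_common_trace.
have /allP/(_ (trace y)) := allP ne2 _ Tx.
by rewrite mem_filter -johnson_adj_trace e_xy; apply.
Qed.

End TracePart.

(* Inside part2 the adjacent vertices {1,2,6} and {1,2,7} have exactly two
   common neighbours, whereas no adjacent pair does inside part1' or part2'. *)
Lemma parts_not_isomorphic :
  ~ isomorphic_partitions johnson_vertices johnson_adj
      [set part1; part2] [set part1'; part2'].
Proof.
move=> [s aut_s eqQ].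
have : s @: part2 \in [set part1'; part2'].
  by rewrite -eqQ imset_f // !inE eqxx orbT.
(* These are {1,2,6} and {1,2,7} with points lowered by one; both have distances 1, 4, 5 and so lie
   in [classD]. *)
have T2x : [:: 0; 1; 5] \in trace_part [:: 3; 4; 5; 6] 1 by vm_compute.
have T2y : [:: 0; 1; 6] \in trace_part [:: 3; 4; 5; 6] 1 by vm_compute.
have [xK Px] := trace_part_of_trace mem_part2 T2x.
have [yK Py] := trace_part_of_trace mem_part2 T2y.
move: (of_trace [:: 0; 1; 5]) (of_trace [:: 0; 1; 6]) xK Px yK Py.
move=> x y xK Px yK Py.
have sP2V : part2 \subset johnson_vertices.
  by apply/subsetP=> z; rewrite mem_part2 => /andP[].
have e_sxy : johnson_adj (s x) (s y).
  move: aut_s; rewrite inE => /andP[_ /forall_inP/(_ x (subsetP sP2V x Px))].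
  move=> /forall_inP/(_ y (subsetP sP2V y Py))/eqP ->.
  by rewrite johnson_adj_trace xK yK.
have common2 := card_common_aut aut_s sP2V Px Py.
rewrite (card_common_trace mem_part2) xK yK in common2.
have [sPx sPy] : s x \in s @: part2 /\ s y \in s @: part2 by split; apply: imset_f.
have num2 : trace_common (trace_part [:: 3; 4; 5; 6] 1)
    [:: 0; 1; 5] [:: 0; 1; 6] = 2 by vm_compute.
(* Whether [part2] goes to [part1'] or to [part2'], the target receives an adjacent pair with two
   common neighbours inside it, which it does not contain. *)
rewrite num2 in common2; move=> /set2P[] eqP; rewrite eqP in common2 sPx sPy.
  have ne2 := common_neq2 mem_part1' _ sPx sPy e_sxy.
  by rewrite common2 in ne2; suff: 2 != 2 by []; apply: ne2; vm_compute.
have ne2 := common_neq2 mem_part2' _ sPx sPy e_sxy.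
by rewrite common2 in ne2; suff: 2 != 2 by []; apply: ne2; vm_compute.
Qed.

(** * The dihedral group as automorphism group of the 10-cycle *)

Lemma val_rot10 a : rot10 a = a.+1 %% 10 :> nat.
Proof. by rewrite permE. Qed.

(** The transpositions swap the points k and 12 - k, whose values add up to 10; the points 1 and 6,
    of values 0 and 5, are fixed. *)
Lemma val_refl10 a : refl10 a = (10 - a) %% 10 :> nat.
Proof.
have ptE k (lt_k : k < 10) : Ordinal lt_k = pt k.+1.
  by apply: val_inj; rewrite /= inordK.
(* The bounds matter: every index outside 1, ..., 10 gives the same ordinal as [pt 1]. *)
have tperm_pt i j k : 0 < i <= 10 -> 0 < j <= 10 -> 0 < k <= 10 ->
    tperm (pt i) (pt j) (pt k) = pt (if k == i then j else if k == j then i else k).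
  have pt_eq m n : 0 < m <= 10 -> 0 < n <= 10 -> (pt m == pt n) = (m == n).
    by case: m n => [|m] [|n] // ? ?; rewrite -val_eqE /= !inordK.
  by move=> ? ? ?; rewrite permE /= !pt_eq //; do 2?case: ifP.
case: a => a lt_a; rewrite ptE !permM.
by do 10?[case: a lt_a => [|a] lt_a //]; rewrite !tperm_pt //= !inordK.
Qed.

(** The normal form modulo 10, a sent to i + a or i - a: permutations compose from left to right, so
    the reflection acts before the rotation. *)
Definition trace_dih (b : bool) (i a : nat) : nat :=
  ((if b then (10 - a) %% 10 else a) + i) %% 10.

Definition dih (b : bool) (i : 'I_10) : {perm 'I_10} := (refl10 ^+ b * rot10 ^+ i)%g.

Lemma val_dih b i a : dih b i a = trace_dih b i a :> nat.
Proof.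
rewrite permM /trace_dih.
have <- : (refl10 ^+ b)%g a = (if b then (10 - a) %% 10 else a) :> nat.
  by case: b; rewrite ?expg1 ?val_refl10 // expg0 perm1.
move: ((refl10 ^+ b)%g a) => c; rewrite permX.
elim: (nat_of_ord i) => [|n IHn]; first by rewrite addn0 modn_small ?ltn_ord.
by rewrite iterS val_rot10 IHn -addn1 modnDml addn1 addnS.
Qed.

Lemma dih_in b i : dih b i \in dihedral10.
Proof. by rewrite groupM ?groupX // mem_gen // !inE eqxx ?orbT. Qed.

Definition trace_cycle_adj (a b : nat) : bool := (b == a.+1 %% 10) || (a == b.+1 %% 10).

Lemma cycle_adjE a b : cycle_adj a b = trace_cycle_adj a b.
Proof. by []. Qed.

Definition cycle_aut := graph_aut [set: 'I_10] cycle_adj.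

Lemma cycle_autP (s : {perm 'I_10}) :
  reflect (forall a b, cycle_adj (s a) (s b) = cycle_adj a b) (s \in cycle_aut).
Proof.
rewrite inE; apply: (iffP andP) => [[_ /forall_inP aut_s] a b|aut_s].
  by have /forall_inP/(_ b (in_setT _))/eqP := aut_s a (in_setT _).
split; first by apply/subsetP=> x; rewrite inE.
by apply/forall_inP=> a _; apply/forall_inP=> b _; rewrite aut_s.
Qed.

Lemma mem_iota10 (a : 'I_10) : nat_of_ord a \in iota 0 10.
Proof. by rewrite mem_iota ltn_ord. Qed.

Lemma ord10_forall2 (q : nat -> nat -> bool) :
  all (fun a => all (q a) (iota 0 10)) (iota 0 10) -> forall a b : 'I_10, q a b.
Proof.
by move=> qP a b; apply: (allP (allP qP a _)); apply: mem_iota10.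
Qed.

(** Automorphisms form a group, so it suffices to check the two generators on all pairs of
    values. *)
Lemma dihedral10_sub_aut : dihedral10 \subset cycle_aut.
Proof.
have autM : group_set cycle_aut.
  apply/group_setP; split=> [|s t /cycle_autP aut_s /cycle_autP aut_t].
    by apply/cycle_autP=> a b; rewrite !perm1.
  by apply/cycle_autP=> a b; rewrite !permM aut_t aut_s.
rewrite -[cycle_aut]/(gval (Group autM)) gen_subG.
apply/subsetP=> s /set2P[]->; apply/cycle_autP=> a b; rewrite !cycle_adjE.
  rewrite !val_rot10; apply/eqP.
  have /ord10_forall2/(_ a b) // : all (fun a => all (fun b =>
    trace_cycle_adj (a.+1 %% 10) (b.+1 %% 10) == trace_cycle_adj a b)
    (iota 0 10)) (iota 0 10) by vm_compute.
rewrite !val_refl10; apply/eqP.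
have /ord10_forall2/(_ a b) // : all (fun a => all (fun b =>
  trace_cycle_adj ((10 - a) %% 10) ((10 - b) %% 10) == trace_cycle_adj a b)
  (iota 0 10)) (iota 0 10) by vm_compute.
Qed.

(* Two automorphisms that agree at [k] and [k.+1] agree at [k.+2], since [k.+1]
   has only two neighbours. *)
Lemma cycle_aut_inj s t : s \in cycle_aut -> t \in cycle_aut ->
  s (pt 1) = t (pt 1) -> s (pt 2) = t (pt 2) -> s = t.
Proof.
move=> /cycle_autP aut_s /cycle_autP aut_t eq1 eq2.
have eqn k : k < 9 -> s (inord k) = t (inord k) /\ s (inord k.+1) = t (inord k.+1).
  elim: k => [//|k IHk] lt_k; have [eqk eqk1] := IHk (ltnW lt_k).
  split=> //.
  have two_nbrs (d b c c' : 'I_10) :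
      cycle_adj d b -> cycle_adj b c -> cycle_adj b c' ->
      c != d -> c' != d -> c = c'.
    rewrite !cycle_adjE -!val_eqE => db bc bc' cd c'd; apply/eqP; rewrite -val_eqE.
    have : all (fun d => all (fun b => all (fun c => all (fun c' =>
      [==> trace_cycle_adj d b, trace_cycle_adj b c, trace_cycle_adj b c',
           c != d, c' != d => c == c'])
      (iota 0 10)) (iota 0 10)) (iota 0 10)) (iota 0 10) by vm_compute.
    move=> /allP/(_ _ (mem_iota10 d))/allP/(_ _ (mem_iota10 b)).
    move=> /allP/(_ _ (mem_iota10 c))/allP/(_ _ (mem_iota10 c')).
    by rewrite db bc bc' cd c'd.
  have lt_k10 : k.+2 < 10 by [].
  have adjS j : j < 9 -> cycle_adj (inord j) (inord j.+1).
    move=> lt_j; rewrite cycle_adjE /trace_cycle_adj !inordK //; last exact: ltnW.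
    by rewrite modn_small ?eqxx.
  have ne_k : inord k.+2 != inord k :> 'I_10.
    rewrite -val_eqE /= !inordK //; last exact: ltn_trans (ltnW _) lt_k10.
    by rewrite gtn_eqF // ltnW.
  apply: (two_nbrs (s (inord k)) (s (inord k.+1))).
  - by rewrite aut_s adjS // ltnW.
  - by rewrite aut_s adjS.
  - by rewrite eqk1 aut_t adjS.
  - by rewrite (inj_eq perm_inj).
  - by rewrite eqk (inj_eq perm_inj).
apply/permP=> a; rewrite -[a]inord_val.
case: (ltnP a 9) => [/eqn[]//|le9a].
(* The first half of [eqn] stops at 8; the last point is reached by its second half. *)
have -> : a = 9 :> nat by apply/eqP; rewrite eqn_leq le9a -ltnS ltn_ord.
by have [] := eqn 8 isT.
Qed.

(** The image of point 1 gives the rotation [i]; that of point 2 is a neighbour of [i], and [b]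
    records whether it fails to be the successor. *)
Lemma cycle_aut_dih s : s \in cycle_aut -> exists b i, s = dih b i.
Proof.
move=> aut_s; pose i := s (pt 1); pose b := s (pt 2) != rot10 i.
exists b, i; apply: cycle_aut_inj => //.
- exact: subsetP dihedral10_sub_aut _ (dih_in b i).
- apply: ord_inj; rewrite val_dih /trace_dih inordK //.
  by case: b; rewrite ?modnn add0n modn_small ?ltn_ord.
apply: ord_inj; rewrite val_dih /trace_dih inordK //.
have : cycle_adj i (s (pt 2)).
  by move/cycle_autP: aut_s => ->; rewrite cycle_adjE !inordK.
rewrite /b; have [-> _ | ne] := eqVneq (s (pt 2)) (rot10 i).
  by rewrite val_rot10 add1n.
have {}ne : s (pt 2) != i.+1 %% 10 :> nat.
  by apply: contra ne => /eqP eq_i; apply/eqP/ord_inj; rewrite val_rot10.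
rewrite cycle_adjE; move: ne => /=.
(* The other neighbour is i - 1, written i + 9, the value of the reflected normal form at 1. *)
have /ord10_forall2/(_ i (s (pt 2))) : all (fun i => all (fun j =>
  (j != i.+1 %% 10) ==> trace_cycle_adj i j ==> (j == (9 + i) %% 10))
  (iota 0 10)) (iota 0 10) by vm_compute.
by move=> /implyP/[apply]/implyP/[apply]/eqP.
Qed.

Lemma dihedral10_aut : dihedral10 = cycle_aut :> {set {perm 'I_10}}.
Proof.
apply/eqP; rewrite eqEsubset dihedral10_sub_aut; apply/subsetP=> s.
by case/cycle_aut_dih=> b [i ->]; apply: dih_in.
Qed.

Lemma dihedral10P (s : {perm 'I_10}) :
  reflect (exists b i, s = dih b i) (s \in dihedral10).
Proof.
apply: (iffP idP) => [|[b [i ->]]]; last exact: dih_in.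
by rewrite dihedral10_aut; apply: cycle_aut_dih.
Qed.

(** * Order and isomorphism type of the dihedral group *)

(** The 2 * 10 normal forms are distinct: the image of value 0 gives [i], then that of value 1,
    either i + 1 or i + 9, gives [b]. *)
Lemma card_dihedral10 : #|dihedral10| = 20.
Proof.
pose f p := dih p.1 p.2.
have f_inj : injective f.
  move=> [b i] [c j] /permP eqf.
  have eqf_at k : k < 10 -> trace_dih b i k = trace_dih c j k.
    move=> lt_k; rewrite -[k]/(val (Ordinal lt_k)).
    by rewrite -!val_dih (eqf (Ordinal lt_k)).
  have eqij : i = j.
    have := eqf_at 0 isT; rewrite /trace_dih !if_same !add0n !modn_small //.
    exact: ord_inj.
  suff eqbc : b = c by rewrite eqbc eqij.
  have := eqf_at 1 isT; rewrite -eqij; clear eqf eqf_at eqij.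
  move: (nat_of_ord i) (mem_iota10 i) => k Ik.
  have /allP/(_ k Ik) : all (fun k => trace_dih true k 1 != trace_dih false k 1)
    (iota 0 10) by vm_compute.
  by case: b c => [] [] // /eqP ne eq1; case: ne.
have -> : dihedral10 = f @: setT :> {set {perm 'I_10}}.
  apply/setP=> s; apply/dihedral10P/imsetP => [[b [i ->]]|[[b i] _ ->]].
    by exists (b, i).
  by exists b, i.
by rewrite card_imset // cardsT card_prod card_bool card_ord.
Qed.

(** Two distinct involutions generate a dihedral group; here they are the reflections a to -a and a
    to 1 - a modulo 10. *)
Lemma dihedral10_isog : (dihedral10 \isog 'D_20)%g.
Proof.
have ord2 (s : {perm 'I_10}) k l :
    (forall a, s (s a) = a) -> s (pt k) = pt l -> pt k != pt l -> #[s]%g = 2.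
  move=> ss sk ne; apply: nt_prime_order => //.
    by apply/permP=> a; rewrite permM perm1.
  by apply: contraNneq ne => s1; rewrite -sk s1 perm1.
have ord_refl : #[refl10]%g = 2.
  apply: (ord2 _ 2 10) => [a||].
  - apply: ord_inj; rewrite !val_refl10.
    move: (nat_of_ord a) (mem_iota10 a) => k Ik; apply/eqP; move: k Ik.
    by apply/allP; vm_compute.
  - by apply: ord_inj; rewrite val_refl10 !inordK.
  - by rewrite -val_eqE /= !inordK.
have ord_rr : #[refl10 * rot10]%g = 2.
  apply: (ord2 _ 1 2) => [a||].
  - apply: ord_inj; rewrite !(permM, val_rot10, val_refl10).
    move: (nat_of_ord a) (mem_iota10 a) => k Ik; apply/eqP; move: k Ik.
    by apply/allP; vm_compute.
  - by apply: ord_inj; rewrite permM val_rot10 val_refl10 !inordK.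
  - by rewrite -val_eqE /= !inordK.
have genE : dihedral10 = <<[set refl10; (refl10 * rot10)%g]>>%G.
  apply/val_inj/eqP; rewrite /= eqEsubset !gen_subG; apply/andP; split.
    apply/subsetP=> s /set2P[]->; last by rewrite mem_gen ?set21.
    (* The rotation is recovered as the inverse of [refl10] times [refl10 * rot10]. *)
    rewrite -[X in X \in _]mul1g -(mulVg refl10) -mulgA.
    by apply: groupM; rewrite ?groupV mem_gen ?set21 ?set22.
  by apply/subsetP=> s /set2P[]->; [|apply: groupM]; rewrite mem_gen ?set21 ?set22.
have := involutions_gen_dihedral ord_refl ord_rr.
rewrite -[<<_>>%g]/(gval <<_>>%G) -genE card_dihedral10; apply.
(* Were the involutions equal, [rot10] would fix [refl10 (pt 1)]. *)
apply/eqP=> eq_rr; have := val_rot10 (refl10 (pt 1)).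
by rewrite -permM -eq_rr val_refl10 inordK.
Qed.

(** * Orbits on the vertices *)

(** Filtering [iota 0 10] puts the moved points back in increasing order, as in a trace. *)
Definition trace_move (b : bool) (i : nat) (s : seq nat) : seq nat :=
  [seq k <- iota 0 10 | k \in [seq trace_dih b i a | a <- s]].

Lemma trace_dih_imset b i (x : {set 'I_10}) :
  trace (dih b i @: x) = trace_move b i (trace x).
Proof.
rewrite /trace_move -of_traceK; congr trace; apply/setP=> a; rewrite [RHS]inE.
apply/imsetP/mapP => [[c xc ->]|[k]].
  by exists (val c); rewrite ?mem_trace // -val_dih.
case/mapP=> c; rewrite mem_enum => xc -> eq_a; exists c => //.
by apply: ord_inj; rewrite val_dih.
Qed.

(** By the normal form an orbit is the list [o] of twenty moved traces; a computation over all pairs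
    of triples compares it with the color. *)
Lemma mem_orbit_johnson x y : x \in johnson_vertices -> y \in johnson_vertices ->
  (y \in orbit ('P^*)%act dihedral10 x) = (color8 (trace x) == color8 (trace y)).
Proof.
move=> /trace_triples Tx /trace_triples Ty.
have : all (fun s =>
    let c := color8 s in
    let o := [seq trace_move b i s | b <- [:: true; false], i <- iota 0 10] in
    all (fun t => (t \in o) == (c == color8 t)) triples) triples by vm_compute.
move=> /allP/(_ _ Tx)/allP/(_ _ Ty)/eqP <-.
apply/orbitP/allpairsP => [[s /dihedral10P[b [i ->]] <-]|[[b i] [_ Ii eq_y]]].
  exists (b, val i); split; first by case: b.
    exact: mem_iota10.
  exact: trace_dih_imset.
rewrite mem_iota /= in Ii; exists (dih b (Ordinal Ii)); first exact: dih_in.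
by apply: (can_inj traceK); rewrite eq_y; apply: trace_dih_imset.
Qed.

Lemma acts_johnson : [acts dihedral10, on johnson_vertices | 'P^*]%g.
Proof.
apply/actsP=> s _ x; rewrite !inE /= card_imset //; exact: act_inj.
Qed.

Lemma orbit_johnson x : x \in johnson_vertices ->
  orbit ('P^*)%act dihedral10 x = dist_class (nth [::] class_dists (color8 (trace x))).
Proof.
move=> Vx; apply/setP=> y; rewrite mem_dist_class ?color8_lt //.
have [Vy|nVy] := boolP (y \in johnson_vertices).
  by rewrite mem_orbit_johnson // eq_sym.
apply: contraNF nVy => /(acts_in_orbit acts_johnson); exact.
Qed.

Lemma orbits_johnson :
  [set orbit ('P^*)%act dihedral10 x | x in johnson_vertices] =
    [set:: [seq dist_class d | d <- class_dists]].
Proof.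
apply/setP=> B; rewrite inE; apply/imsetP/mapP => [[x Vx ->]|[d d_in ->]].
  rewrite orbit_johnson //.
  by exists (nth [::] class_dists (color8 (trace x))); rewrite // mem_nth ?color8_lt.
(* Each of the eight multisets is realised by some triple, whose orbit is then the class. *)
have /allP/(_ d d_in)/hasP[s /triples_trace[sK Vs] /eqP cs] : all (fun d =>
  has (fun s => nth [::] class_dists (color8 s) == d) triples) class_dists.
  by vm_compute.
by exists (of_trace s); rewrite // orbit_johnson // sK cs.
Qed.

Theorem mainTheorem3 :
  [/\ #|dihedral10| = 20,
      (dihedral10 \isog 'D_20)%g,
      dihedral10 = graph_aut [set: 'I_10] cycle_adj :> {set {perm 'I_10}} &
      [acts dihedral10, on johnson_vertices | 'P^*]%g]
  /\
  [set orbit ('P^*)%act dihedral10 x | x in johnson_vertices] =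
    [set:: [:: classA; classB; classC; classD;
               classE; classF; classG; classH]]
  /\
  perfect_coloring johnson_vertices johnson_adj
    [tuple classA; classB; classC; classD; classE; classF; classG; classH]
    quotient8
  /\
  [/\ perfect_coloring johnson_vertices johnson_adj
        [tuple part1; part2] quotient2,
      perfect_coloring johnson_vertices johnson_adj
        [tuple part1'; part2'] quotient2 &
      ~ isomorphic_partitions johnson_vertices johnson_adj
          [set part1; part2] [set part1'; part2']].
Proof.
split.
  split; [exact: card_dihedral10 | exact: dihedral10_isog
         | exact: dihedral10_aut | exact: acts_johnson].
split; first exact: orbits_johnson.
split; first exact: classes_coloring.
split; [exact: parts_coloring | exact: parts'_coloring | exact: parts_not_isomorphic].
Qed.
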